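(* If $T$ is a tree of order $n$ with matching number $\beta=\beta(T)\ge 2$, then $$\mathrm{aecc}_3(T)\ge \mathrm{aecc}_3(T_{n,n-\beta}).$$
   Context: For a connected graph $G$ with $n(G)$ vertices and $S\subseteq V(G)$, the Steiner distance $d_G(S)$ is the minimum number of edges of a connected subgraph of $G$ containing $S$. For $v\in V(G)$, $\mathrm{ecc}_3(v,G)=\max\{d_G(S): v\in S\subseteq V(G), |S|=3\}$, and $\mathrm{aecc}_3(G)=\frac{1}{n(G)}\sum_{v\in V(G)}\mathrm{ecc}_3(v,G)$. The matching number $\beta(T)$ is the maximum cardinality of a matching of $T$. For $m\ge 2$ and $m+1\le n\le 2m+1$, $T_{n,m}$ is the tree of order $n$ obtained from the star $K_{1,m}$ by choosing $n-m-1$ of its $m$ pendent vertices and attaching exactly one new pendent edge to each of them. *)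

(* Defs.v *)
From mathcomp Require Import all_boot all_order all_algebra.

Set Implicit Arguments.
Unset Strict Implicit.
Unset Printing Implicit Defensive.

Record sgraph := SGraph {
  svertex :> finType;
  sedge : rel svertex;
  sedge_sym : symmetric sedge;
  sedge_irr : irreflexive sedge
}.

Definition edges (G : sgraph) : {set {set G}} :=
  [set [set p.1; p.2] | p : G * G & sedge p.1 p.2].

Definition is_connected (G : sgraph) : Prop :=
  0 < #|G| /\ forall x y : G, connect (@sedge G) x y.

(* [ucycle] counts x, y, x (with xy an edge) as a cycle of size 2; graph-theoretic
   cycles are those of size at least 3. *)
Definition is_acyclic (G : sgraph) : Prop :=
  forall c : seq G, ucycle (@sedge G) c -> size c <= 2.

Definition is_tree (G : sgraph) : Prop := is_connected G /\ is_acyclic G.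

(* A subgraph is a pair (W, F) of a vertex set and an edge set. *)
Definition subgraph (G : sgraph) (H : {set G} * {set {set G}}) : bool :=
  (H.2 \subset edges G) && [forall f in H.2, f \subset H.1].

Definition subgraph_connected (G : sgraph) (H : {set G} * {set {set G}}) : bool :=
  [forall x in H.1, forall y in H.1,
     connect (fun u v : G => [set u; v] \in H.2) x y].

(* The default candidate (setT, edges G) is G itself, which is admissible
   whenever G is connected. *)
Definition steiner_dist (G : sgraph) (S : {set G}) : nat :=
  #|[arg min_(H < (setT, edges G) |
       [&& subgraph H, subgraph_connected H & S \subset H.1]) #|H.2| ].2|.

Definition ecc3 (G : sgraph) (v : G) : nat :=
  \max_(S : {set G} | (v \in S) && (#|S| == 3)) steiner_dist S.

Definition aecc3 (G : sgraph) : rat :=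
  ((\sum_(v : G) ecc3 v)%:R / #|G|%:R)%R.

Definition is_matching (G : sgraph) (M : {set {set G}}) : bool :=
  (M \subset edges G) && trivIset M.

Definition matching_number (G : sgraph) : nat :=
  \max_(M : {set {set G}} | is_matching M) #|M|.

(* Vertex 0 is the centre of the star K_{1,m}, vertices 1..m are its pendent
   vertices, and each remaining vertex m + i is attached to vertex i. *)
Definition Tnm_arc (m i j : nat) : bool :=
  ((i == 0) && (0 < j <= m)) || ((0 < i <= m) && (j == i + m)).

Definition Tnm_rel (n m : nat) : rel 'I_n :=
  fun i j => Tnm_arc m i j || Tnm_arc m j i.

Lemma Tnm_sym n m : symmetric (@Tnm_rel n m).
Proof. by move=> i j; rewrite /Tnm_rel orbC. Qed.

Lemma Tnm_irr n m : irreflexive (@Tnm_rel n m).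
Proof.
move=> i; rewrite /Tnm_rel orbb /Tnm_arc; apply/negbTE.
rewrite negb_or !negb_and -[X in X == i + m]addn0 eqn_add2l.
by case: (nat_of_ord i) m => [|k] [|m] //=; rewrite orbT.
Qed.

(* Meaningful for 2 <= m and m + 1 <= n <= 2m + 1. *)
Definition Tnm (n m : nat) : sgraph := SGraph (@Tnm_sym n m) (@Tnm_irr n m).

(* Main.v *)
Require Import Defs.
From mathcomp Require Import all_boot all_order all_algebra.
From mathcomp Require Import zify.
Import GRing.Theory Num.Theory.

(** In a tree, a connected subgraph containing the ends of a path contains the
    whole path, so a path with d edges forces ecc_3 >= d everywhere, and
    ecc_3 >= d + 1 off the path; its two ends also gain one as soon as some
    vertex lies off the path.
    If every vertex starts a path with 3 edges, then there is a path with 5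
    edges, and this suffices when beta >= 3. Otherwise some vertex c starts no
    such path, and every matching edge avoiding c is the outer edge of a path
    c, a, b. There are at least beta - 1 of these legs, pairwise disjoint. Three
    legs give ecc_3 >= 6 at every vertex at distance 2 from c and ecc_3 >= 5 at
    every vertex other than c; two legs give a path with 4 edges, which settles
    beta = 3. When beta = 2, there is a path with 3 edges.
    In each case the bound is the value of the sum for T_{n,n-beta}, where the
    ancestors of a triple give an explicit connected subgraph. *)

(** * Paths and walks in acyclic graphs *)

Section Acyclic.
Variable G : sgraph.
Hypothesis acG : is_acyclic G.
Implicit Types (x y z : G) (p : seq G) (r : rel G).

(** The edge closes the path into a cycle, which has at most two vertices. *)
Lemma acyclic_edge_path x y p :
  sedge x y -> path (@sedge G) x p -> uniq (x :: p) -> last x p = y ->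
  p = [:: y].
Proof.
move=> exy xp up lp.
have /acG /= : ucycle (@sedge G) (x :: p).
  by rewrite /ucycle up andbT /= rcons_path xp lp sedge_sym.
case: p lp {xp up} => [|z [|]] //= => [xy|->] //.
by rewrite xy sedge_irr in exy.
Qed.

Lemma acyclic_bridge r x y :
  subrel r (@sedge G) -> sedge x y -> connect r x y -> r x y.
Proof.
move=> re exy /connectP[p xp yE]; case/shortenP: xp yE => q xq uq _ yE.
have qE := acyclic_edge_path _ _ _ exy (sub_path re xq) uq (esym yE).
by move: xq; rewrite qE /= andbT.
Qed.

(* If r missed the first edge xy, then going along r to the end of the path and
   back along the path to y would join x to y without using the edge xy. *)
Lemma acyclic_path_unique r x p :
  subrel r (@sedge G) -> symmetric r -> path (@sedge G) x p -> uniq (x :: p) ->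
  connect r x (last x p) -> path r x p.
Proof.
move=> re rs; elim: p x => //= y p IH x /andP[exy yp] /andP[xNp up] cxl.
have rxy : r x y.
  apply/negP => nrxy.
  pose r2 := [rel u v | sedge u v
    && ~~ ((u == x) && (v == y) || (u == y) && (v == x))] : rel G.
  have r2s : symmetric r2.
    by move=> u v; rewrite /r2 /= sedge_sym orbC andbC [(u == y) && _]andbC
      [(u == x) && _]andbC andbC.
  have: r2 x y; last by rewrite /r2 /= !eqxx andbF.
  apply: acyclic_bridge => //; first by move=> u v /andP[].
  apply: (@connect_trans _ _ (last y p)).
    apply: connect_sub cxl => u v ruv; apply: connect1; rewrite /r2 /=.
    rewrite re //=; apply/negP => /orP[]/andP[/eqP uE /eqP vE].
      by apply: nrxy; rewrite -uE -vE.
    by apply: nrxy; rewrite rs -uE -vE.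
  rewrite (sym_connect_sym r2s); apply/connectP; exists p => //.
  apply: (@sub_in_path _ (predC1 x) (@sedge G) r2) yp => [u v ux vx euv|].
    by move: ux vx; rewrite /r2 /= euv !inE => /negbTE-> /negbTE->; rewrite andbF.
  apply/allP => z zp; apply: contraNneq xNp => <-; exact: zp.
rewrite rxy IH //; apply: connect_trans cxl.
by apply: connect1; rewrite rs.
Qed.

(** If [x] recurred, the stretch from [y] to [x] would join the ends of an edge, hence be a single
    step, and [x] would be the head of [p]. *)
Lemma acyclic_nonbacktracking x y p :
  sedge x y -> path (@sedge G) y p -> uniq (y :: p) -> x != head y p ->
  uniq [:: x, y & p].
Proof.
move=> exy yp up xh; rewrite cons_uniq up andbT in_cons negb_or.
have -> /= : x != y by apply: contraTneq exy => ->; rewrite sedge_irr.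
apply/negP => xp; case/splitPr: xp yp up xh => p1 p2.
rewrite -cat_rcons cat_path -cat_cons cat_uniq => /andP[yp1 _] /andP[up1 _].
rewrite sedge_sym in exy.
have := acyclic_edge_path _ _ _ exy yp1 up1 (last_rcons _ _ _).
by case: p1 {yp1 up1} => [|a [|]] //=; rewrite eqxx.
Qed.

(** Only vertices two steps apart are compared. In an acyclic graph this already makes a walk a
    path, so simplicity of explicit walks reduces to a few inequalities. *)
Fixpoint nonbacktracking (V : eqType) (s : seq V) : bool :=
  if s is x :: s' then
    (if s' is y :: z :: _ then x != z else true) && nonbacktracking V s'
  else true.

Lemma nonbacktracking_uniq x p :
  path (@sedge G) x p -> nonbacktracking _ (x :: p) -> uniq (x :: p).
Proof.
elim: p x => // y p IH x /andP[exy yp] /andP[xz nb].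
apply: acyclic_nonbacktracking (IH y yp nb) _ => //.
case: p {IH yp nb} xz => //= _.
by apply: contraTneq exy => ->; rewrite sedge_irr.
Qed.

End Acyclic.

Lemma connected_card (V : finType) (F : {set {set V}}) (x : V) (X : {set V}) :
  (forall y, y \in X -> connect (fun u v => [set u; v] \in F) x y) ->
  #|X| <= #|F|.+1.
Proof.
move=> cX.
(* A largest set satisfying P is closed under F: adding the other end of a
   crossing edge would preserve P. *)
pose P (Y : {set V}) := (x \in Y) && (#|Y| <= #|[set f in F | f \subset Y]|.+1).
have P1 : P [set x] by rewrite /P set11 cards1.
case: (arg_maxnP (fun Y : {set V} => #|Y|) P1) => Y /andP[xY cY] maxY.
have step u v : [set u; v] \in F -> u \in Y -> v \in Y.
  move=> uvF uY; apply/negPn/negP => vY.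
  have: #|v |: Y| <= #|Y|.
    apply: maxY; rewrite /P setU1r //= cardsU1 vY add1n ltnS.
    apply: leq_trans cY _; apply: proper_card; apply/properP; split.
      apply/subsetP => f; rewrite !inE => /andP[-> fY] /=.
      by apply: subset_trans fY (subsetU1 _ _).
    exists [set u; v]; rewrite !inE uvF subUset !sub1set ?(negbTE vY) ?andbF //.
    by rewrite !inE eqxx uY orbT.
  by rewrite cardsU1 vY add1n ltnn.
apply: leq_trans (leq_trans cY _).
  apply: subset_leq_card; apply/subsetP => y /cX cxy.
  rewrite -(closed_connect _ cxy) // => u v uvF.
  by apply/idP/idP; apply: step; rewrite // setUC.
by rewrite ltnS; apply: subset_leq_card; apply/subsetP => f; rewrite inE => /andP[].
Qed.

(** * Steiner distances in trees, and eccentricity bounds from paths *)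

Section Steiner.
Variable G : sgraph.
Implicit Types (S X : {set G}) (x y z : G) (p : seq G).

Lemma in_edges x y : ([set x; y] \in edges G) = sedge x y.
Proof.
apply/imsetP/idP => [[[u v] /=]|exy]; last by exists (x, y); rewrite ?inE.
rewrite inE /= => euv /setP E.
have := E x; have := E y; have := E u; have := E v; rewrite !inE !eqxx ?orbT /=.
move=> vE uE yE xE.
case/esym/orP: xE => /eqP xE; case/esym/orP: yE => /eqP yE; subst x y.
- by move: vE; rewrite orbb => /eqP vu; rewrite vu sedge_irr in euv.
- done.
- by rewrite sedge_sym.
- by move: uE; rewrite orbb => /eqP vu; rewrite vu sedge_irr in euv.
Qed.

Definition steiner_admissible S (H : {set G} * {set {set G}}) :=
  [&& subgraph H, subgraph_connected H & S \subset H.1].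

Lemma steiner_spec S : is_connected G ->
  exists2 H, steiner_admissible S H & steiner_dist S = #|H.2| /\
    forall H', steiner_admissible S H' -> #|H.2| <= #|H'.2|.
Proof.
move=> [_ cG]; rewrite /steiner_dist.
case: arg_minnP => [|H aH minH]; last by exists H.
rewrite /subgraph /= subxx subsetT andbT /=; apply/andP; split.
  by apply/forallP => f; rewrite subsetT implybT.
apply/forallP => x; apply/implyP => _; apply/forallP => y; apply/implyP => _ /=.
by rewrite (eq_connect (e' := @sedge G)) // => u v; rewrite in_edges.
Qed.

(** An optimal subgraph connects [s] to the end of each such path, so by [acyclic_path_unique] it
    uses the whole path. Its edges thus connect [s] to all of [X], and [connected_card] counts
    them. *)
Lemma steiner_hull S X s : is_tree G -> s \in S ->
  (forall x, x \in X -> exists p, [/\ path (@sedge G) s p, uniq (s :: p),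
     last s p \in S & x \in s :: p]) ->
  #|X| <= (steiner_dist S).+1.
Proof.
move=> [cG aG] sS hX.
have [H /and3P[/andP[Hs _] /forallP Hc /subsetP HS] [-> _]] := steiner_spec S cG.
apply: (@connected_card _ _ s) => x /hX[p [sp up lS xp]].
have/implyP/(_ (HS _ sS))/forallP/(_ (last s p))/implyP/(_ (HS _ lS)) := Hc s.
move=> cl; have rp := acyclic_path_unique _ aG _ _ _ _ _ sp up cl.
apply: (path_connect (rp _ _)) => // [u v|u v]; last by rewrite setUC.
by move/(subsetP Hs); rewrite in_edges.
Qed.

Lemma ecc3_ge S x : x \in S -> #|S| = 3 -> steiner_dist S <= ecc3 x.
Proof.
move=> xS S3.
by apply: (@leq_bigmax_cond _ (fun S : {set G} => (x \in S) && (#|S| == 3))); rewrite xS S3 /=.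
Qed.

Lemma connected_path x y : is_connected G ->
  exists p, [/\ path (@sedge G) x p, uniq (x :: p) & last x p = y].
Proof.
move=> [_ /(_ x y)/connectP[p xp yE]]; case/shortenP: xp yE => q xq uq _ yE.
by exists q.
Qed.

Lemma path_ecc3 x p t y : is_tree G -> path (@sedge G) x p -> uniq (x :: p) ->
  0 < size p -> t != x -> t != last x p -> y \in [set x; last x p; t] ->
  size p + (t \notin x :: p) <= ecc3 y.
Proof.
move=> tG xp up p0 tx tl yS.
have S3 : #|[set x; last x p; t]| = 3.
  rewrite -setUA cardsU1 cards2 !inE ![_ == t]eq_sym (negbTE tx) (negbTE tl).
  rewrite orbF eq_sym; case: p up p0 {xp tl yS} => //= z p /andP[xNp _] _.
  by have -> // : last z p != x; apply: contraNneq xNp => <-; apply: mem_last.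
apply: leq_trans (ecc3_ge _ _ yS S3).
rewrite -ltnS; have -> : (size p + (t \notin x :: p)).+1 = #|[set z in t :: x :: p]|.
  rewrite cardsE; have /card_uniqP sE := up.
  by rewrite (eq_card (B := [predU1 t & [in x :: p]])) // cardU1 sE /= addnS addnC.
apply: (@steiner_hull _ _ x) => //; first by rewrite !inE eqxx.
move=> z; rewrite inE in_cons => /orP[/eqP ->|zp].
  have [q [xq uq lq]] := connected_path x t (proj1 tG).
  by exists q; rewrite lq; split; rewrite // -?lq ?mem_last // lq !inE eqxx orbT.
by exists p; split => //; rewrite !inE eqxx orbT.
Qed.

(** A vertex other than the ends is itself the third member of the triple; for an end, the second
    vertex of the path serves, being an inner one. *)
Lemma path_ecc3_ge x p y : is_tree G -> path (@sedge G) x p -> uniq (x :: p) ->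
  1 < size p -> size p <= ecc3 y.
Proof.
move=> tG xp up p1.
have [yS|] := boolP (y \in [set x; last x p]); last first.
  rewrite !inE negb_or => /andP[yx yl].
  apply: leq_trans (leq_addr _ _) (path_ecc3 _ _ _ _ tG xp up _ yx yl _) => //.
    exact: ltnW.
  by rewrite !inE eqxx orbT.
have [t [tx tl]] : exists t, t != x /\ t != last x p.
  case: p up p1 {xp yS} => [|a [|b p]] //= /and3P[xN aN _] _.
  exists a; split; first by apply: contraNneq xN => <-; rewrite mem_head.
  by apply: contraNneq aN => ->; rewrite mem_last.
apply: leq_trans (leq_addr _ _) (path_ecc3 _ _ _ _ tG xp up _ tx tl _) => //.
  exact: ltnW.
by rewrite inE yS.
Qed.

Lemma sum_const_ind (V : finType) (A : {set V}) c :
  \sum_(v : V) (c + (v \in A)) = c * #|V| + #|A|.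
Proof.
rewrite big_split /= sum_nat_const mulnC; congr (_ + _).
by rewrite -sum1_card [RHS]big_mkcond; apply: eq_bigr => v _; case: (v \in A).
Qed.

Lemma path_sum_ge x p : is_tree G -> path (@sedge G) x p -> uniq (x :: p) ->
  1 < size p -> size p * #|G| <= \sum_(y : G) ecc3 y.
Proof.
move=> tG xp up p1; rewrite mulnC -sum_nat_const.
by apply: leq_sum => y _; apply: path_ecc3_ge xp up p1.
Qed.

(** Only the inner vertices [I] miss the extra one: a vertex off the path is its own third member,
    and the ends use some [w] off the path. *)
Lemma path_sum_gt x p : is_tree G -> path (@sedge G) x p -> uniq (x :: p) ->
  1 < size p -> (size p).+1 < #|G| ->
  size p * #|G| + (#|G| - (size p).-1) <= \sum_(y : G) ecc3 y.
Proof.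
move=> tG xp up p1 pG.
pose I := [set z in x :: p] :\ x :\ last x p.
have pos : 0 < size p by exact: ltnW.
have lx : last x p != x.
  case: p up pos {xp p1 pG I} => //= z p /andP[xNp _] _.
  by apply: contraNneq xNp => <-; apply: mem_last.
have cI : #|I| = (size p).-1.
  have := cardsD1 x [set z in x :: p]; rewrite cardsE (card_uniqP up) /= inE mem_head.
  have := cardsD1 (last x p) ([set z in x :: p] :\ x); rewrite -/I !inE lx -in_cons mem_last /=.
  lia.
rewrite -cI; have <- : #|~: I| = #|G| - #|I| by rewrite [LHS]cardsCs setCK.
rewrite -sum_const_ind.
have [w wN] : exists w, w \notin x :: p.
  apply/existsP; apply: contraLR pG; rewrite negb_exists -leqNgt => /forallP wP.
  rewrite -[(size p).+1]/(size (x :: p)) -(card_uniqP up); apply: subset_leq_card.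
  by apply/subsetP => w _; rewrite -[_ \in _]negbK.
have wx : w != x by apply: contraNneq wN => ->; apply: mem_head.
have wl : w != last x p by apply: contraNneq wN => ->; apply: mem_last.
apply: leq_sum => y _.
have [yS|yN] := boolP (y \in [set x; last x p]).
  apply: leq_trans (path_ecc3 _ _ w _ tG xp up pos wx wl _); last by rewrite inE yS.
  by rewrite wN leq_add2l leq_b1.
move: (yN); rewrite !inE negb_or => /andP[yx yl]; rewrite yx yl /= -in_cons.
by apply: path_ecc3 => //; rewrite !inE eqxx orbT.
Qed.

(** * Long paths from a vertex, and matchings *)

(** In a tree this says that the ordinary eccentricity of [x] is at least [k]. *)
Definition starts_path k x :=
  [exists t : k.-tuple G, path (@sedge G) x t && uniq (x :: t)].

Lemma starts_pathI k x p : path (@sedge G) x p -> uniq (x :: p) -> k <= size p ->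
  starts_path k x.
Proof.
move=> xp up kp; have tP : size (take k p) == k by rewrite size_takel.
apply/existsP; exists (Tuple tP) => /=; rewrite take_path //=.
by move: up; rewrite -{1}(cat_take_drop k p) -cat_cons cat_uniq => /and3P[].
Qed.

Lemma edge_path_from c u v : is_connected G -> sedge u v -> c \notin [set u; v] ->
  exists p a b, [/\ [set a; b] = [set u; v], path (@sedge G) c (p ++ [:: a; b])
                & uniq (c :: p ++ [:: a; b])].
Proof.
move=> cG euv cN.
have [q [cq uq lq]] := connected_path c u cG.
have uv : u != v by apply: contraTneq euv => ->; rewrite sedge_irr.
move: cN; rewrite !inE negb_or => /andP[cu cv].
(* If the path to [u] passes [v], it is cut at [v] and continued to [u]; otherwise it is prolonged
   to [v]. *)
have [vq|vNq] := boolP (v \in q).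
  case/splitPr: vq cq uq lq => p1 p2.
  rewrite -cat_rcons cat_path last_cat last_rcons => /andP[cp1 _] uq lq.
  exists p1, v, u; rewrite setUC; split=> //.
    rewrite -cat_rcons -[_ ++ _]/(_ ++ [:: u]) cats1 rcons_path cp1 last_rcons /=.
    by rewrite sedge_sym.
  have up2 : u \in p2.
    case: (p2) lq => [/= vu|w p2' /= <-]; last exact: mem_last.
    by rewrite vu eqxx in uv.
  rewrite -cat_cons cat_uniq in uq; case/and3P: uq => uq1 /hasPn/(_ u up2) uN _.
  by rewrite -cat_rcons cats1 -rcons_cons rcons_uniq uq1 andbT.
exists (take (size q).-1 q), u, v.
case/lastP: q cq uq lq vNq => [/= _ _ /eqP|q w]; first by rewrite (negbTE cu).
rewrite last_rcons size_rcons /= => cq uq wu; subst w => vNq.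
rewrite -cats1 take_size_cat // -cat_rcons cats1.
split=> //; first by rewrite rcons_path cq last_rcons.
by rewrite rcons_uniq vNq mem_rcons inE (negbTE cv).
Qed.

Lemma edge_leg c u v : is_connected G -> sedge u v -> c \notin [set u; v] ->
  starts_path 2 c /\
  (~~ starts_path 3 c ->
   exists a b, [/\ [set a; b] = [set u; v], sedge c a, sedge a b & b != c]).
Proof.
move=> cG euv cN.
have [p [a [b [abE cp up]]]] := edge_path_from _ _ _ cG euv cN.
split.
  by apply: starts_pathI cp up _; rewrite size_cat addn2.
move=> nP; case: p cp up => [|w p] cp up; last first.
  by case/negP: nP; apply: starts_pathI cp up _; rewrite size_cat addn2.
exists a, b; move: cp up => /= /and3P[ca ab _]; rewrite !inE negb_or.
by case/andP=> /andP[_]; rewrite eq_sym.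
Qed.

(** Matching edges are disjoint, so at most one contains [c]. *)
Lemma matching_avoid (M : {set {set G}}) c : is_matching M ->
  #|M| <= #|[set f in M | c \notin f]|.+1.
Proof.
case/andP=> _ /trivIsetP tM.
rewrite -(cardsID [set f : {set G} | c \in f] M) -addn1 addnC leq_add //.
  apply: subset_leq_card; apply/subsetP => f.
  by rewrite !inE andbC.
apply/card_le1_eqP => f g; rewrite !inE => /andP[fM cf] /andP[gM cg].
apply: contraTeq cf => fg; apply/negP => cf.
by have /pred0P/(_ c) := tM g f gM fM fg; rewrite /= cf cg.
Qed.

Lemma matchingP : exists2 M : {set {set G}}, is_matching M & matching_number G = #|M|.
Proof.
have h0 : is_matching (set0 : {set {set G}}).
  rewrite /is_matching sub0set; apply/trivIsetP => A B; rewrite inE //.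
rewrite /matching_number (bigmax_eq_arg set0) //.
by case: arg_maxnP => // M hM _; exists M.
Qed.

Lemma edgeP (f : {set G}) : f \in edges G -> exists u v, sedge u v /\ f = [set u; v].
Proof. by case/imsetP=> [[u v]]; rewrite inE /= => euv ->; exists u, v. Qed.

Lemma matching_card (M : {set {set G}}) : is_matching M -> #|M| * 2 <= #|G|.
Proof.
case/andP=> /subsetP ME /eqP tM; rewrite -sum_nat_const.
apply: leq_trans (max_card (cover M)); rewrite -tM; apply: leq_sum => f /ME/edgeP[u [v [euv ->]]].
by rewrite cards2; case: eqP euv => // ->; rewrite sedge_irr.
Qed.

Lemma starts_path2 c : is_connected G -> 1 < matching_number G -> starts_path 2 c.
Proof.
move=> cG; have [M hM ->] := matchingP => M1.
have := matching_avoid _ c hM; move/(leq_trans M1); rewrite ltnS => /card_gt0P[f].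
rewrite inE => /andP[fM cf]; case/andP: hM => /subsetP/(_ f fM)/edgeP[u [v [euv fE]]] _.
by rewrite fE in cf; have [] := edge_leg _ _ _ cG euv cf.
Qed.

End Steiner.

(** * Lower bounds for the sum of eccentricities in a tree *)

Section LowerBound.
Variable G : sgraph.
Hypothesis tG : is_tree G.
Implicit Types (x y c : G) (p : seq G) (f : {set G}) (M : {set {set G}}).

Let walk_uniq x p := @nonbacktracking_uniq G (proj2 tG) x p.

(** Given [c, x, y] and [x, u, v], the path is [c, x, u, v], or [y, x, c, v] when [u = c]. *)
Lemma starts_path2_long : (forall c, starts_path G 2 c) ->
  exists x p, [/\ path (@sedge G) x p, uniq (x :: p) & size p = 3].
Proof.
move=> h; have /card_gt0P[c _] := proj1 (proj1 tG).
have /existsP[[[|x [|y [|]]] //= _]] := h c.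
rewrite !inE !negb_or => /and3P[/andP[cx /andP[xy _]] /andP[_ cNy] _].
have /existsP[[[|u [|v [|]]] //= _]] := h x.
rewrite !inE !negb_or => /and3P[/andP[xu /andP[uv _]] /andP[_ xNv] _].
have [uc|uNc] := eqVneq u c; last first.
  have P : path (@sedge G) c [:: x; u; v] by rewrite /= cx xu uv.
  exists c, [:: x; u; v]; split=> //; apply: walk_uniq P _.
  by rewrite /= [c == u]eq_sym uNc xNv.
subst u.
have P : path (@sedge G) y [:: x; c; v] by rewrite /= sedge_sym xy xu uv.
exists y, [:: x; c; v]; split=> //; apply: walk_uniq P _.
by rewrite /= [y == c]eq_sym cNy xNv.
Qed.

(** Start from [a, b, c, d]. A path from [b] not beginning with [c] is prolonged backwards by
    [c, d], and one from [c] not beginning with [b] by [b, a]. Otherwise both run along the edge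
    [bc] in opposite directions, and their union has five edges. *)
Lemma starts_path3_long : (forall c, starts_path G 3 c) ->
  exists x p, [/\ path (@sedge G) x p, uniq (x :: p) & size p = 5].
Proof.
have h3 : (forall c, starts_path G 3 c) -> forall c, exists x y z,
    [/\ sedge c x, sedge x y, sedge y z, c != y & x != z].
  move=> h c; have /existsP[[[|x [|y [|z [|]]]] //= _]] := h c.
  rewrite !inE !negb_or => /andP[/and4P[cx xy yz _] /andP[/and3P[_ cNy _] /and3P[/andP[_ xNz] _ _]]].
  by exists x, y, z.
move=> /h3 {}h3; have /card_gt0P[a _] := proj1 (proj1 tG).
have [b [c [d [ab bc cd aNc bNd]]]] := h3 a.
have [y1 [y2 [y3 [by1 y12 y23 bNy2 y1Ny3]]]] := h3 b.
have [y1c|y1Nc] := eqVneq y1 c; last first.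
  have P : path (@sedge G) d [:: c; b; y1; y2; y3].
    by rewrite /= sedge_sym cd sedge_sym bc by1 y12 y23.
  exists d, [:: c; b; y1; y2; y3]; split=> //; apply: walk_uniq P _.
  by rewrite /= [d == b]eq_sym bNd [c == y1]eq_sym y1Nc bNy2 y1Ny3.
subst y1.
have [z1 [z2 [z3 [cz1 z12 z23 cNz2 z1Nz3]]]] := h3 c.
have [z1b|z1Nb] := eqVneq z1 b; last first.
  have P : path (@sedge G) a [:: b; c; z1; z2; z3].
    by rewrite /= ab bc cz1 z12 z23.
  exists a, [:: b; c; z1; z2; z3]; split=> //; apply: walk_uniq P _.
  by rewrite /= aNc [b == z1]eq_sym z1Nb cNz2 z1Nz3.
subst z1.
have P : path (@sedge G) z3 [:: z2; b; c; y2; y3].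
  by rewrite /= sedge_sym z23 sedge_sym z12 bc y12 y23.
exists z3, [:: z2; b; c; y2; y3]; split=> //; apply: walk_uniq P _.
by rewrite /= [z3 == b]eq_sym z1Nz3 [z2 == c]eq_sym cNz2 bNy2 y1Ny3.
Qed.

Definition is_leg c f :=
  exists a b, [/\ f = [set a; b], sedge c a, sedge a b & b != c].

Lemma matching_legs M c : is_matching M -> ~~ starts_path G 3 c ->
  exists2 M', is_matching M' & #|M| <= #|M'|.+1 /\ forall f, f \in M' -> is_leg c f.
Proof.
move=> hM n3; exists [set f in M | c \notin f].
  case/andP: hM => ME tM; apply/andP; split.
    by apply: subset_trans ME; apply/subsetP => f; rewrite inE => /andP[].
  by apply: trivIsetS tM; apply/subsetP => f; rewrite inE => /andP[].
split=> [|f]; first exact: matching_avoid.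
rewrite inE => /andP[fM cf].
case/andP: hM => /subsetP/(_ f fM)/edgeP[u [v [euv fE]]] _; subst f.
have [_ /(_ n3)[a [b [E ca ab bc]]]] := edge_leg _ _ _ _ (proj1 tG) euv cf.
by exists a, b.
Qed.

(** Two disjoint legs glued at [c] form a path with four edges, which [x] can meet only in [c]. *)
Lemma two_legs M c x : is_matching M -> (forall f, f \in M -> is_leg c f) ->
  1 < #|[set f in M | x \notin f]| ->
  exists a b a' b',
    [/\ path (@sedge G) b [:: a; c; a'; b'], uniq [:: b; a; c; a'; b'],
        x \notin [set a; b] & x \notin [set a'; b']].
Proof.
move=> /andP[_ /trivIsetP tM] hL /card_gt1P[f [g []]].
rewrite !inE => /andP[fM xf] /andP[gM xg] fg.
have [a [b [fE ca ab bc]]] := hL f fM.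
have [a' [b' [gE ca' ab' bc']]] := hL g gM.
exists a, b, a', b'; rewrite -fE -gE.
have aa' : a != a'.
  apply: contraTneq isT => E; have /pred0P/(_ a) := tM f g fM gM fg.
  by rewrite /= fE gE !inE -E eqxx.
have P : path (@sedge G) b [:: a; c; a'; b'].
  by rewrite /= sedge_sym ab sedge_sym ca ca' ab'.
split=> //; apply: walk_uniq => //=.
by rewrite bc aa' eq_sym bc'.
Qed.

Lemma legs_long M c : is_matching M -> (forall f, f \in M -> is_leg c f) ->
  1 < #|M| ->
  exists x p, [/\ path (@sedge G) x p, uniq (x :: p) & size p = 4].
Proof.
(* No leg contains [c], so taking [x] to be [c] discards none. *)
move=> hM hL M2; have [|a [b [a' [b' [P U _ _]]]]] := two_legs _ _ c hM hL.
  apply: leq_trans M2 _; apply: subset_leq_card; apply/subsetP => f fM.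
  rewrite inE fM /=; have [a [b [-> ca ab bc]]] := hL f fM.
  rewrite !inE negb_or eq_sym [c == b]eq_sym bc andbT.
  by apply: contraTneq ca => ->; rewrite sedge_irr.
by exists b, [:: a; c; a'; b'].
Qed.

Lemma legs_sum M c : is_matching M -> (forall f, f \in M -> is_leg c f) ->
  2 < #|M| -> 5 * #|G| + #|M| <= (\sum_(x : G) ecc3 x).+1.
Proof.
move=> hM hL M3.
have M2 x : 1 < #|[set f in M | x \notin f]|.
  by have := matching_avoid _ _ x hM; lia.
(* [B] is the set of vertices at distance two from [c]. It contains the outer end of every leg, and
   [g] selects a member from each of the disjoint legs. *)
pose B := [set v | [exists u, [&& sedge c u, sedge u v & v != c]]].
have MB : #|M| <= #|B|.
  pose g f := odflt c [pick v in f :&: B].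
  have gP f : f \in M -> g f \in f :&: B.
    move=> fM; rewrite /g; case: pickP => //= F.
    have [a [b [fE ca ab bc]]] := hL f fM.
    have := F b; rewrite fE !inE eqxx orbT /=.
    by move/existsP; case; exists a; rewrite ca ab.
  rewrite -(card_in_imset (f := g)).
    by apply: subset_leq_card; apply/subsetP => v /imsetP[f /gP + ->]; rewrite inE => /andP[].
  move=> f h fM hM'; have := gP f fM; have := gP h hM'.
  rewrite !inE => /andP[gh _] /andP[gf _] gE; apply: contraTeq isT => fh.
  case/andP: hM => _ /trivIsetP/(_ f h fM hM' fh)/pred0P/(_ (g f)).
  by rewrite /= gf gE gh.
(* At [c] only 4 is guaranteed; this deficit of one is the [.+1] of the statement. *)
suff S v : 5 + (v \in B) <= ecc3 v + (v \in [set c]).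
  apply: (@leq_trans (\sum_(v : G) (5 + (v \in B)))).
    by rewrite sum_const_ind leq_add2l.
  apply: (@leq_trans (\sum_(v : G) (ecc3 v + (v \in [set c]))));
    first by apply: leq_sum.
  rewrite big_split /= -addn1 leq_add2l.
  have E : \sum_(v : G) (v \in [set c] : nat) = 1.
    exact: etrans (sum_const_ind _ [set c] 0) (cards1 c).
  by rewrite E.
have [vc|vNc] := eqVneq v c.
  have [a [b [a' [b' [P U _ _]]]]] := two_legs _ _ c hM hL (M2 c).
  have := @path_ecc3_ge G b [:: a; c; a'; b'] v tG P U isT.
  have -> : v \in B = false.
    by rewrite inE vc; apply/existsP => -[u]; rewrite eqxx !andbF.
  by rewrite vc inE eqxx /=; lia.
rewrite [v \in [set c]]inE (negbTE vNc) addn0.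
have [|vNB] := boolP (v \in B); last first.
  have [a [b [a' [b' [P U]]]]] := two_legs _ _ v hM hL (M2 v).
  rewrite !inE !negb_or => /andP[va vb] /andP[va' vb'].
  have := @path_ecc3 G b [:: a; c; a'; b'] v v tG P U isT vb vb'.
  rewrite !inE !negb_or vb va vNc va' vb' eqxx orbT => /(_ isT) /=.
  by lia.
rewrite inE => /existsP[u /and3P[cu uv _]].
(* Two legs missing [u] form with [v, u, c] a spider on seven vertices, so the triple of its ends
   needs six edges. *)
have [a [b [a' [b' [P3 U3]]]]] := two_legs _ _ u hM hL (M2 u).
rewrite !inE !negb_or => /andP[ua ub] /andP[ua' ub'].
have vu : sedge v u by rewrite sedge_sym.
have uc : sedge u c by rewrite sedge_sym.
move: (P3) => /= /and5P[ba ac ca' ab' _].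
have bNc : b != c by move: U3; rewrite /= !inE !negb_or => /andP[/and4P[]].
have b'Nc : c != b' by move: U3; rewrite /= !inE !negb_or => /and4P[_ _ /andP[]].
have P1 : path (@sedge G) v [:: u; c; a; b].
  by rewrite /= vu uc sedge_sym ac sedge_sym ba.
have P2 : path (@sedge G) v [:: u; c; a'; b'] by rewrite /= vu uc ca' ab'.
have U1 : uniq [:: v; u; c; a; b].
  by apply: walk_uniq => //=; rewrite vNc ua eq_sym bNc.
have U2 : uniq [:: v; u; c; a'; b'].
  by apply: walk_uniq => //=; rewrite vNc ua' b'Nc.
(* Any two of the seven vertices lie together on one of the three paths. *)
have UX : uniq [:: v; u; c; a; b; a'; b'].
  move: U1 U2 U3; rewrite /= !inE !negb_or.
  move=> ? ? ?.
  repeat match goal with H : is_true (_ && _) |- _ => case/andP: H => ? ? end.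
  by repeat (apply/andP; split); rewrite // eq_sym.
pose S := [set v; b; b'].
have S3 : #|S| = 3.
  suff -> : S = [set z in [:: v; b; b']].
    rewrite cardsE; apply/card_uniqP.
    by apply: (mask_uniq UX [:: true; false; false; false; true; false; true]).
  by apply/setP => z; rewrite !inE orbA.
have vS : v \in S by rewrite !inE eqxx.
apply: leq_trans (ecc3_ge _ _ _ vS S3).
rewrite -ltnS.
have -> : 6.+1 = #|[set z in [:: v; u; c; a; b; a'; b']]|.
  by rewrite cardsE (card_uniqP UX).
apply: (steiner_hull _ _ _ _ tG vS) => z; rewrite inE.
have -> : [:: v; u; c; a; b; a'; b'] = [:: v; u; c; a; b] ++ [:: a'; b'] by [].
rewrite mem_cat => /orP[zX|zX].
  by exists [:: u; c; a; b]; split; rewrite // !inE eqxx orbT.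
exists [:: u; c; a'; b']; split; rewrite // ?inE ?eqxx ?orbT //.
by move: zX; rewrite !inE => /orP[]->; rewrite ?orbT.
Qed.

End LowerBound.

(** * Upper bounds for the extremal tree, with [k] attached pendent edges *)

Section Extremal.
Variables m k : nat.
Hypothesis k0 : 0 < k.
Hypothesis km : k < m.
Let T := Tnm (m + k).+1 m.
Implicit Types (i j v : T) (S : {set T}).

Let nat_of i : nat := nat_of_ord (i : 'I_(m + k).+1).
Let root : T := (ord0 : 'I_(m + k).+1).
(* The truncated subtraction sends the root and its neighbours to the root. *)
Let parent i : T := (inord (nat_of i - m) : 'I_(m + k).+1).

Let nat_of_le i : nat_of i <= m + k.
Proof. exact: ltn_ord (i : 'I_(m + k).+1). Qed.

Let parentE i : nat_of (parent i) = nat_of i - m.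
Proof. by apply: inordK; rewrite ltnS; have := nat_of_le i; lia. Qed.

Let rootE : nat_of root = 0. Proof. by []. Qed.

Let nat_of_inj i j : nat_of i = nat_of j -> i = j.
Proof. exact: val_inj. Qed.

Let parent_edge i : 0 < nat_of i -> sedge i (parent i).
Proof.
move=> i0; rewrite /sedge /= /Tnm_rel.
rewrite -/(nat_of i) -/(nat_of (parent i)) parentE /Tnm_arc.
by have := nat_of_le i; lia.
Qed.

Let parent_root i : nat_of i <= m -> parent i = root.
Proof.
move=> im; apply: nat_of_inj; rewrite parentE rootE; lia.
Qed.

(** The depth is at most two. The relation is left general to serve both the whole tree and the
    subgraphs spanned by ancestors. *)
Let connect_parent (r : rel T) i : symmetric r ->
  (0 < nat_of i -> r i (parent i)) ->
  (m < nat_of i -> r (parent i) root) -> connect r i root.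
Proof.
move=> rs h1 h2; have [i0|i0] := posnP (nat_of i).
  by rewrite (nat_of_inj i root i0) connect0.
have [im|im] := leqP (nat_of i) m.
  by apply: connect1; rewrite -(parent_root _ im) h1.
by apply: connect_trans (connect1 (h1 i0)) (connect1 (h2 im)).
Qed.

Let Tnm_connected : is_connected T.
Proof.
split; first by apply/card_gt0P; exists root.
have toroot i : connect (@sedge T) i root.
  apply: connect_parent => [||im]; [exact: sedge_sym|exact: parent_edge|].
  have pm : nat_of (parent i) <= m by rewrite parentE; have := nat_of_le i; lia.
  by rewrite -(parent_root _ pm); apply: parent_edge; rewrite parentE; lia.
move=> x y; apply: connect_trans (toroot x) _.
by rewrite (sym_connect_sym (@sedge_sym T)).
Qed.

(** Joining every vertex of [U] to its parent gives a connected subgraph on [U] and the root, with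
    at most one edge per member of [U]. *)
Let steiner_le S (U : {set T}) :
  root \notin U -> (forall i, i \in S -> 0 < nat_of i -> i \in U) ->
  (forall i, i \in U -> m < nat_of i -> parent i \in U) ->
  steiner_dist S <= #|U|.
Proof.
move=> rU SU UU.
have Upos i : i \in U -> 0 < nat_of i.
  by move=> iU; rewrite lt0n; apply: contraNneq rU => i0; rewrite -(_ : i = root) //; apply: nat_of_inj.
pose F : {set {set T}} := [set [set i; parent i] | i in U].
have [H aH [-> minH]] := steiner_spec T S Tnm_connected.
apply: leq_trans (minH (root |: U, F) _) (leq_imset_card _ _).
apply/and3P; split.
- apply/andP; split; rewrite /=.
    apply/subsetP => f /imsetP[i iU ->]; have := parent_edge i (Upos i iU).
    by rewrite -in_edges.
  apply/forall_inP => f /imsetP[i iU ->].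
  rewrite subUset !sub1set !inE iU orbT /=.
  have [im|im] := leqP (nat_of i) m; first by rewrite parent_root // eqxx.
  by rewrite UU // orbT.
- pose r := fun u v : T => [set u; v] \in F.
  have rs : symmetric r by move=> u v; rewrite /r setUC.
  have toroot i : i \in root |: U -> connect r i root.
    rewrite !inE => /orP[/eqP ->|iU]; first exact: connect0.
    apply: connect_parent => // [_|im]; first by apply/imsetP; exists i.
    have pm : nat_of (parent i) <= m by rewrite parentE; have := nat_of_le i; lia.
    by rewrite -(parent_root _ pm); apply/imsetP; exists (parent i); rewrite ?UU.
  apply/forall_inP => x /toroot xr; apply/forall_inP => y /toroot yr.
  by apply: connect_trans xr _; rewrite (sym_connect_sym rs).
apply/subsetP => i iS; rewrite !inE; have [i0|i0] := posnP (nat_of i).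
  by rewrite -(_ : i = root) ?eqxx //; apply: nat_of_inj.
by rewrite SU ?orbT.
Qed.

Let far : {set T} := [set i | m < nat_of i].

Let card_far : #|far| <= k.
Proof.
rewrite -[k]card_ord.
have h i : i \in far -> nat_of i - m.+1 < k by rewrite inE; have := nat_of_le i; lia.
case: k k0 h => // k' _ h.
rewrite -(card_in_imset (f := fun i => inord (nat_of i - m.+1) : 'I_k'.+1)) ?max_card //.
move=> i j iF jF /(congr1 val); rewrite /= !inordK ?h //.
move: iF jF; rewrite !inE => iF jF E; apply: nat_of_inj; lia.
Qed.

(** Each member of [S] pays for the edge to its parent, and far members in [A] also for the edge
    above the parent; outside [A] the parent lies in [S] and pays for itself. *)
Let steiner_le_far S (A : {set T}) : (forall i, i \in S -> i \in far -> i \notin A -> parent i \in S) ->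
  steiner_dist S <= #|S :\ root| + #|S :&: far :&: A|.
Proof.
move=> hA; apply: (@leq_trans #|(S :\ root) :|: (parent @: (S :&: far :&: A))|).
  apply: steiner_le.
  - rewrite !inE eqxx /=; apply/imsetP => -[i]; rewrite !inE => /andP[/andP[_ im] _].
    by move/(congr1 nat_of); rewrite parentE rootE; lia.
  - move=> i iS i0; rewrite !inE iS andbT; apply/orP; left.
    by apply: contraTneq i0 => ->.
  - move=> i; rewrite !inE => /orP[/andP[ir iS]|/imsetP[j _ E]] im; last first.
      move: im; rewrite E parentE.
      by have := nat_of_le j; lia.
    have [iA|iA] := boolP (i \in A).
      by apply/orP; right; apply/imsetP; exists i; rewrite // !inE iS im.
    rewrite hA ?inE // andbT; apply/orP; left.
    apply/eqP => /(congr1 nat_of); rewrite parentE rootE; lia.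
rewrite cardsU; apply: leq_trans (leq_subr _ _) _.
by rewrite leq_add2l leq_imset_card.
Qed.

(** The cases are the centre, its neighbours carrying a pendent edge, its other neighbours, and the
    attached vertices. The second entries reflect that only [k] vertices are far. *)
Definition Tnm_bound (u : nat) : nat :=
  if u == 0 then minn 4 k.+2 else if u <= k then minn 5 k.+2
  else if u <= m then minn 5 k.+3 else minn 6 k.+3.

Lemma Tnm_ecc3_le (i : T) : ecc3 i <= Tnm_bound (i : 'I_(m + k).+1).
Proof.
apply/bigmax_leqP => S /andP[iS /eqP S3].
have St : steiner_dist S <= #|S :\ root| + #|S :&: far|.
  by have := steiner_le_far S setT; rewrite setIT; apply => j _ _; rewrite inE.
have c1 : #|S :\ root| + (root \in S) = 3 by rewrite addnC -cardsD1.
have c2 : #|S :&: far| <= k.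
  by apply: leq_trans card_far; apply: subset_leq_card; apply: subsetIr.
have c3 : #|S :&: far| + (i \notin far) <= 3.
  rewrite -S3; have [iF|iF] := boolP (i \in far); rewrite /=.
    by rewrite addn0; apply: subset_leq_card; apply: subsetIl.
  rewrite (cardsD1 i S) iS addnC.
  rewrite leq_add2l; apply: subset_leq_card; apply/subsetP => j; rewrite !inE.
  by case/andP=> -> jF; rewrite andbT; apply: contraNneq iF => <-; rewrite inE.
rewrite inE -leqNgt in c3.
rewrite /Tnm_bound -/(nat_of i).
have [i0|i0] := eqVneq (nat_of i) 0.
  have ir : i = root by apply: nat_of_inj.
  by move: c1 c3 St; rewrite -ir iS i0; lia.
have [ik|ik] := leqP (nat_of i) k; last first.
  by have [im|im] := leqP (nat_of i) m; lia.
have im : nat_of i <= m by lia.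
rewrite im in c3.
(* [j] is the vertex attached to [i]. If it is in [S], its parent [i] is there already; if not, at
   most [k - 1] far vertices are in [S]. Either way one edge is saved. *)
have [j jE] : exists j : T, nat_of j = nat_of i + m.
  exists (inord (nat_of i + m) : 'I_(m + k).+1); rewrite /nat_of inordK //.
  by rewrite -/(nat_of i); lia.
have pj : parent j = i by apply: nat_of_inj; rewrite parentE jE; lia.
have jF : j \in far by rewrite inE jE; lia.
have [jS|jS] := boolP (j \in S).
  have St' : steiner_dist S <= #|S :\ root| + #|(S :&: far) :\ j|.
    rewrite [in X in _ + X]setDE; apply: steiner_le_far => j' _ _.
    by rewrite !inE negbK => /eqP ->; rewrite pj.
  have cj : #|S :&: far| = 1 + #|(S :&: far) :\ j|.
    by rewrite (cardsD1 j) inE jS jF.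
  by lia.
have c4 : #|S :&: far| < k.
  apply: leq_trans card_far; apply: proper_card; apply/properP; split; first exact: subsetIr.
  by exists j; rewrite // inE (negbTE jS).
lia.
Qed.

Lemma Tnm_sum_le :
  \sum_(i : T) ecc3 i <=
  minn 4 k.+2 + k * minn 5 k.+2 + (m - k) * minn 5 k.+3 + k * minn 6 k.+3.
Proof.
apply: (@leq_trans (\sum_(i < (m + k).+1) Tnm_bound i)).
  by apply: leq_sum => i _; apply: Tnm_ecc3_le.
(* Once the centre is split off, index [i] stands for vertex [i.+1]. *)
rewrite -(big_mkord xpredT) big_nat_recl //.
rewrite (@big_cat_nat _ _ _ k) //=; last by lia.
rewrite (@big_cat_nat _ _ _ m k) //=; [|by lia|by lia].
rewrite (@eq_big_nat _ _ _ 0 k _ (fun=> minn 5 k.+2)); last first.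
  by move=> i hi; rewrite /Tnm_bound /=; have -> : i < k by lia.
rewrite (@eq_big_nat _ _ _ k m _ (fun=> minn 5 k.+3)); last first.
  move=> i hi; rewrite /Tnm_bound /=; have -> : i < k = false by lia.
  by have -> : i < m by lia.
rewrite (@eq_big_nat _ _ _ m (m + k) _ (fun=> minn 6 k.+3)); last first.
  move=> i hi; rewrite /Tnm_bound /=; have -> : i < k = false by lia.
  by have -> : i < m = false by lia.
rewrite !sum_nat_const_nat subn0 addKn /Tnm_bound /=.
by rewrite !addnA.
Qed.

(** The whole tree has [m + k] edges. For [k = 1] and [m = 2] this gives 12, where [Tnm_sum_le]
    gives only 14. *)
Lemma Tnm_sum_le_order : \sum_(i : T) ecc3 i <= (m + k).+1 * (m + k).
Proof.
have cT : #|T| = (m + k).+1 by rewrite card_ord.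
rewrite -{1}cT -sum_nat_const; apply: leq_sum => i _; apply/bigmax_leqP => S _.
have -> : m + k = #|~: [set root]| by have := cardsC1 root; rewrite cT => ->.
by apply: steiner_le => [|j _|j _]; rewrite !inE ?eqxx // => h; apply/eqP => /(congr1 nat_of);
  rewrite ?parentE rootE; lia.
Qed.

End Extremal.

(** * Comparison of the two sums *)

Theorem theorem5p4 (T : sgraph) (n : nat) (hT : is_tree T) (hn : #|T| = n)
    (hbeta : 2 <= matching_number T) :
  (aecc3 (Tnm n (n - matching_number T)) <= aecc3 T)%R.
Proof.
have [M hM EM] := matchingP T.
have M2 := matching_card _ _ hM; rewrite -EM hn in M2.
(* Here [k < m] because the matched vertices number [2 * k.+1 <= n]. *)
have [m [k [nE k0 km mE]]] : exists m k,
    [/\ n = (m + k).+1, 0 < k, k < m & matching_number T = k.+1].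
  by exists (n - matching_number T), (matching_number T).-1; split; lia.
have -> : n - matching_number T = m by lia.
rewrite /aecc3 hn nE card_ord.
apply: ler_wpM2r; first by rewrite invr_ge0 ler0n.
rewrite ler_nat; rewrite nE in hn.
have [k1|k1] := eqVneq k 1.
  have st c := starts_path2 T c (proj1 hT) hbeta.
  have [x [p [P U p3]]] := starts_path2_long T hT st.
  have := path_sum_gt T x p hT P U; rewrite p3 hn k1 => /(_ isT).
  have := path_sum_ge T x p hT P U; rewrite p3 hn k1 => /(_ isT).
  have := Tnm_sum_le m 1 isT; rewrite -{1}k1 => /(_ km).
  have := Tnm_sum_le_order m 1 isT; rewrite -{1}k1 => /(_ km).
  (* For [m = 2] both sums are compared with 12; for larger [m] the path gives [4 * n - 2], which
     equals the bound of [Tnm_sum_le]. *)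
  have [->|m2] := eqVneq m 2; lia.
apply: (leq_trans (Tnm_sum_le m k k0 km)).
have [/forallP st|] := boolP [forall c, starts_path T 3 c].
  have [x [p [P U p5]]] := starts_path3_long T hT st.
  have := path_sum_gt T x p hT P U; rewrite p5 hn => /(_ isT).
  have := path_sum_ge T x p hT P U; rewrite p5 hn => /(_ isT).
  (* For [k = 2] the bound [5 * n] suffices; beyond that the extra [n - 4] is needed. *)
  have [->|k2] := eqVneq k 2; first by lia.
  have -> : minn 4 k.+2 = 4 by lia.
  have -> : minn 5 k.+2 = 5 by lia.
  have -> : minn 5 k.+3 = 5 by lia.
  have -> : minn 6 k.+3 = 6 by lia.
  by lia.
rewrite negb_forall => /existsP[c nst].
have [M' hM' [MM' legs]] := matching_legs T hT M c hM nst.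
have kM' : k <= #|M'| by lia.
(* For [k = 2] the path with four edges gives exactly [5 * n - 3]; for larger [k] the legs give
   [5 * n + k - 1]. Both match [Tnm_sum_le]. *)
have [k2|k2] := eqVneq k 2.
  have M'1 : 1 < #|M'| by lia.
  have [x [p [P U p4]]] := legs_long T hT M' c hM' legs M'1.
  have := path_sum_gt T x p hT P U; rewrite p4 hn k2 => /(_ isT).
  by lia.
have M'2 : 2 < #|M'| by lia.
have := legs_sum T hT M' c hM' legs M'2; rewrite hn.
have -> : minn 4 k.+2 = 4 by lia.
have -> : minn 5 k.+2 = 5 by lia.
have -> : minn 5 k.+3 = 5 by lia.
have -> : minn 6 k.+3 = 6 by lia.
by lia.
Qed.
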